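(* Let $c\in\mathbb{C}^n$ and $d_1,\dots,d_m\in\mathbb{C}^{n+1}$ be random vectors following complex elliptically symmetric distributions with the same characteristic generator $\psi$, and let $\Phi$ be the cumulative distribution function of the corresponding standard (one-dimensional) elliptical distribution. For $z\in\mathbb{C}^n$ put $\tilde z=[z^T,1]^T$ and $\varphi_i(z)=\mathrm{Re}(d_i\tilde z)$, with mean $\mu_{\varphi_i(z)}$ and standard deviation $\sigma_{\varphi_i(z)}$. Then, for $p_i\in[0.5,1)$, the probabilistic constraint $$\mathbb{P}[\varphi_i(z)\le 0]\ge p_i,\qquad i=1,\dots,m,$$ is equivalent to $$\mu_{\varphi_i(z)}+\Phi^{-1}(p_i)\,\sigma_{\varphi_i(z)}\le 0,\qquad i=1,\dots,m.$$ Moreover, if the probability constraints are individual (that is, $p_0,p_1,\dots,p_m\in[0.5,1)$ are fixed constants), then the problem $$\min_{z\in\mathbb{C}^n,\ t\in\mathbb{R}}\ t\quad\text{s.t.}\quad \mathbb{P}[\mathrm{Re}(c^Hz)\le t]\ge p_0,\qquad \mathbb{P}[\varphi_i(z)\le 0]\ge p_i,\ i=1,\dots,m,$$ is (equivalent to) a convex second-order cone problem in the real variables $(\mathrm{Re}(z),\mathrm{Im}(z),t)$.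
   Context: A random vector $d\in\mathbb{C}^{N}$ with mean $\mu_d$, covariance $\Gamma_d=\mathbb{E}[(d-\mu_d)(d-\mu_d)^H]$ and pseudo-covariance $J_d=\mathbb{E}[(d-\mu_d)(d-\mu_d)^T]$ follows a complex elliptically symmetric (CES) distribution with characteristic generator $\psi$ if its characteristic function $\Xi_d(u)=\mathbb{E}[\exp(i\,\mathrm{Re}(u^Hd))]$, $u\in\mathbb{C}^N$, is $\Xi_d(u)=\exp(i\,\mathrm{Re}(u^H\mu_d))\,\psi\left(u^H\Gamma_du+\mathrm{Re}(u^HJ_d\bar u)\right)$. The product $d_i\tilde z$ is the bilinear product $\sum_j (d_i)_j\tilde z_j$ ($d_i=[a_i\ b_i]$ being written as a row vector). The standard elliptical distribution is the real distribution with characteristic function $s\mapsto\psi(2s^2)$, i.e. the common law of the standardized variables $(\varphi_i(z)-\mu_{\varphi_i(z)})/\sigma_{\varphi_i(z)}$ when $\sigma_{\varphi_i(z)}>0$. $\Phi^{-1}$ denotes the quantile function $\Phi^{-1}(p)=\inf\{x:\Phi(x)\ge p\}$. A convex second-order cone problem minimizes a linear function of real variables $x$ subject to finitely many constraints of the form $\|M_jx+q_j\|\le f_j^Tx+g_j$.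
   Formalization: In the second-order cone claim, if one of p_0,...,p_m equals 1/2, it is also assumed that Φ(x) < 1/2 for all x < 0 (0 is the only median); otherwise, e.g. for a random-sign law, Φ^{-1}(1/2) < 0 and the feasible set can be nonconvex. *)

(* Defs.v *)
From HB Require Import structures.
From mathcomp Require Import all_boot all_order all_algebra.
From mathcomp Require Import complex.
From mathcomp Require Import all_classical all_reals all_analysis.

Set Implicit Arguments.
Unset Strict Implicit.
Unset Printing Implicit Defensive.

Import Order.TTheory GRing.Theory Num.Theory.

Local Open Scope classical_set_scope.
Local Open Scope ring_scope.
Local Open Scope complex_scope.
Local Open Scope sesquilinear_scope.

Section complex_random_vectors.
Context {R : realType} {dT : measure_display} {T : measurableType dT}.
Variable P : probability T R.

Definition cexpectation (Z : T -> R[i]) : R[i] :=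
  fine 'E_P[fun w => complex.Re (Z w)] +i* fine 'E_P[fun w => complex.Im (Z w)].

(* Square integrability makes the mean, covariance and pseudo-covariance
   finite; membership in [Lfun] includes measurability. *)
Definition L2_vector (N : nat) (d : T -> 'cV[R[i]]_N) : Prop :=
  forall j, (fun w => complex.Re (d w j 0)) \in Lfun P 2%:E /\
            (fun w => complex.Im (d w j 0)) \in Lfun P 2%:E.

Definition mean_vector (N : nat) (d : T -> 'cV[R[i]]_N) : 'cV[R[i]]_N :=
  \col_j cexpectation (fun w => d w j 0).

Definition covariance_matrix (N : nat) (d : T -> 'cV[R[i]]_N) : 'M[R[i]]_N :=
  \matrix_(j, k) cexpectation (fun w =>
    ((d w - mean_vector d) *m (d w - mean_vector d) ^t*) j k).

Definition pseudo_covariance_matrix (N : nat) (d : T -> 'cV[R[i]]_N) :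
    'M[R[i]]_N :=
  \matrix_(j, k) cexpectation (fun w =>
    ((d w - mean_vector d) *m (d w - mean_vector d)^T) j k).

Definition expi (x : R) : R[i] := cos x +i* sin x.

Definition char_fun_vector (N : nat) (d : T -> 'cV[R[i]]_N)
    (u : 'cV[R[i]]_N) : R[i] :=
  cexpectation (fun w => expi (complex.Re ((u ^t* *m d w) 0 0))).

Definition char_fun_real (X : T -> R) (s : R) : R[i] :=
  cexpectation (fun w => expi (s * X w)).

(* [u^H Gamma u] is real, so taking its real part only changes its type.
   Only the values of [psi] on nonnegative reals are constrained. *)
Definition CES (N : nat) (psi : R -> R[i]) (d : T -> 'cV[R[i]]_N) : Prop :=
  L2_vector d /\
  forall u : 'cV[R[i]]_N,
    char_fun_vector d u =
      expi (complex.Re ((u ^t* *m mean_vector d) 0 0)) *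
      psi (complex.Re ((u ^t* *m covariance_matrix d *m u) 0 0) +
           complex.Re ((u ^t* *m pseudo_covariance_matrix d *m map_mx Num.conj u)
                         0 0)).

Definition standard_elliptical (psi : R -> R[i]) (X : {RV P >-> R}) : Prop :=
  forall s : R, char_fun_real X s = psi (2 * s ^+ 2).

Definition mean (X : T -> R) : R := fine 'E_P[X].

Definition std_dev (X : T -> R) : R := Num.sqrt (fine 'V_P[X]).

End complex_random_vectors.

Section chance_constraints.
Context {R : realType}.

Definition quantile (Phi : R -> \bar R) (p : R) : R :=
  inf [set x | (p%:E <= Phi x)%E].

(* The standard elliptical law is symmetric about 0; for its distribution function
   this says that 0 is its only median.  Without it a constraint at level 1/2
   can be nonconvex: for [d = m + e v] with [e] a random sign and [m], [v]
   fixed vectors, [psi t = cos (sqrt (t / 2))] is the generator, [Phi] is the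
   distribution function of [e], its 1/2-quantile is -1, and
   P[Re (d z~) <= 0] >= 1/2 holds iff Re (m z~) <= |Re (v z~)|. *)
Definition zero_unique_median (Phi : R -> \bar R) : Prop :=
  forall x : R, x < 0 -> (Phi x < (2^-1)%:E)%E.

Definition ztilde (n : nat) (z : 'cV[R[i]]_n) : 'cV[R[i]]_(n + 1) :=
  col_mx z 1%:M.

(* Bilinear product, without conjugation. *)
Definition phi (T : Type) (n : nat) (d : T -> 'cV[R[i]]_(n + 1))
    (z : 'cV[R[i]]_n) (w : T) : R :=
  complex.Re (((d w)^T *m ztilde z) 0 0).

Record opt_problem (V : Type) := OptProblem {
  objective : V -> R ;
  feasible : set V }.

Definition equivalent_via (V W : Type) (f : V -> W)
    (A : opt_problem V) (B : opt_problem W) : Prop :=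
  bijective f /\
  forall v, objective A v = objective B (f v) /\
            (feasible A v <-> feasible B (f v)).

(* The norm on ['cV[R]_r] in the library is the sup norm. *)
Definition norm2 (r : nat) (v : 'cV[R]_r) : R :=
  Num.sqrt (\sum_(j < r) v j 0 ^+ 2).

Record soc_constraint (k : nat) := SOCConstraint {
  soc_dim : nat ;
  soc_M : 'M[R]_(soc_dim, k) ;
  soc_q : 'cV[R]_soc_dim ;
  soc_f : 'cV[R]_k ;
  soc_g : R }.

Definition soc_holds (k : nat) (C : soc_constraint k) (x : 'cV[R]_k) : Prop :=
  norm2 (soc_M C *m x + soc_q C) <= ((soc_f C)^T *m x) 0 0 + soc_g C.

Definition socp (k L : nat) (h : 'cV[R]_k) (C : 'I_L -> soc_constraint k) :
    opt_problem 'cV[R]_k :=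
  OptProblem (fun x => (h^T *m x) 0 0) [set x | forall l, soc_holds (C l) x].

Definition real_coordinates (n : nat) (zt : 'cV[R[i]]_n * R) :
    'cV[R]_(n + n + 1) :=
  col_mx (col_mx (map_mx (@complex.Re R) zt.1) (map_mx (@complex.Im R) zt.1))
         (zt.2)%:M.

Definition chance_problem (dT : measure_display) (T : measurableType dT)
    (P : probability T R) (n m : nat) (c : T -> 'cV[R[i]]_n)
    (d : 'I_m -> T -> 'cV[R[i]]_(n + 1)) (p0 : R) (p : 'I_m -> R) :
    opt_problem ('cV[R[i]]_n * R) :=
  OptProblem (fun zt => zt.2)
    [set zt : 'cV[R[i]]_n * R |
      (p0%:E <= P [set w | (complex.Re (((c w) ^t* *m zt.1) 0 0) <= zt.2)%R])%E
      /\ forall i, ((p i)%:E <= P [set w | (phi (d i) zt.1 w <= 0)%R])%E].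

End chance_constraints.

(* Main.v *)
Require Import Defs.
From mathcomp Require Import all_boot all_order all_algebra.
From mathcomp Require Import complex.
From mathcomp Require Import all_classical all_reals all_analysis.
From mathcomp Require Import measurable_realfun ring lra.

(** The characteristic function of Re(u^H d) is, by the CES hypothesis and the
    identity u^H Gamma u + Re(u^H J conj(u)) = 2 Var(Re(u^H d)), that of mu + sigma X
    with X standard elliptical.  Equality of characteristic functions gives equality of
    distribution functions: bounded functions with the same expectation under two laws
    are closed under linear combinations and bounded pointwise limits, contain all
    trigonometric polynomials, and the step functions are iterated limits of the
    polynomials (1 - g^n)^(n 2^n) with g = (1 + sin(s (a - y))) / 2.  The chance
    constraint thus reads Phi((t - mu) / sigma) >= p, that is mu + Phi^-1(p) sigma <= t.
    As X and - X have the same law, Phi^-1(p) >= 0 for p > 1/2 (for p = 1/2, this is the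
    uniqueness of the median); since sigma is the Euclidean norm of
    an affine function of the variables (factor the covariance matrix as M^T M), the
    constraint is a second-order cone constraint. *)

Set Implicit Arguments.
Unset Strict Implicit.
Unset Printing Implicit Defensive.

Import Order.TTheory GRing.Theory Num.Theory.
Import numFieldNormedType.Exports.
Local Open Scope classical_set_scope.
Local Open Scope ring_scope.

(** * Integrability and expectation of real random variables *)

Section mean_theory.
Context {R : realType} {dT : measure_display} {T : measurableType dT}.
Variable P : probability T R.
Implicit Types (f g : T -> R) (a : R).

Lemma Lfun2_Lfun1 f : f \in Lfun P 2%:E -> f \in Lfun P 1.
Proof. by apply: Lfun_subset12; rewrite fin_num_measure. Qed.

Lemma meanD f g : f \in Lfun P 1 -> g \in Lfun P 1 ->
  mean P (fun w => f w + g w) = mean P f + mean P g.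
Proof.
by move=> f1 g1; rewrite /mean expectationD// fineD// expectation_fin_num.
Qed.

Lemma meanZ a f : f \in Lfun P 1 -> mean P (fun w => a * f w) = a * mean P f.
Proof.
move=> f1; rewrite /mean -[RHS](@fineM _ a%:E) ?expectation_fin_num//.
rewrite -expectationZl//; congr (fine (expectation _ _)).
by apply/funext => w /=; rewrite mulrC.
Qed.

Lemma mean_cst a : mean P (fun=> a) = a.
Proof. by rewrite /mean -[X in expectation _ X]/(cst a) expectation_cst. Qed.

Lemma Lfun_cst1 a : (fun=> a) \in Lfun P 1.
Proof. exact: Lfun_cst. Qed.

Lemma Lfun1Z a f : f \in Lfun P 1 -> (fun w => a * f w) \in Lfun P 1.
Proof.
move=> fL; rewrite (_ : (fun=> _) = a \o* f) ?Lfun_scale// ?ler1n//.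
by apply/funext => w /=; rewrite mulrC.
Qed.

Lemma Lfun2Z a f : f \in Lfun P 2%:E -> (fun w => a * f w) \in Lfun P 2%:E.
Proof.
move=> fL; rewrite (_ : (fun=> _) = a \o* f) ?Lfun_scale// ?ler1n//.
by apply/funext => w /=; rewrite mulrC.
Qed.

Lemma Lfun1D f g : f \in Lfun P 1 -> g \in Lfun P 1 ->
  (fun w => f w + g w) \in Lfun P 1.
Proof. by move=> f1 g1; rewrite -[X in X \in _]/(f \+ g) rpredD. Qed.

Lemma Lfun2D f g : f \in Lfun P 2%:E -> g \in Lfun P 2%:E ->
  (fun w => f w + g w) \in Lfun P 2%:E.
Proof. by move=> f2 g2; rewrite -[X in X \in _]/(f \+ g) rpredD ?lee1n. Qed.

Lemma mean_ge0 f : (forall w, 0 <= f w) -> 0 <= mean P f.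
Proof. by move=> f0; rewrite fine_ge0// expectation_ge0. Qed.

Lemma mean_sum (I : Type) (r : seq I) (F : I -> T -> R) :
  (forall i, F i \in Lfun P 1) ->
  (fun w => \sum_(i <- r) F i w) \in Lfun P 1 /\
  mean P (fun w => \sum_(i <- r) F i w) = \sum_(i <- r) mean P (F i).
Proof.
move=> F1; elim: r => [|i r [IH1 IH2]].
  under eq_fun do rewrite big_nil.
  by rewrite big_nil mean_cst Lfun_cst1.
under eq_fun do rewrite big_cons.
by rewrite big_cons meanD// IH2; split=> //; exact: Lfun1D.
Qed.

Lemma bounded_Lfun1 (f : T -> R) (M : R) :
  measurable_fun [set: T] f -> (forall w, `|f w| <= M) -> f \in Lfun P 1.
Proof.
move=> mf fM; apply/Lfun1_integrable; apply: measurable_bounded_integrable => //.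
  by rewrite (le_lt_trans (probability_le1 _ _))// ltry.
by exists M; split=> [|x Mx w _ /=]; rewrite ?num_real// (le_trans (fM w))// ltW.
Qed.

(** Dominated convergence, with the constant [M] as dominating function; it is integrable because
    [P] is finite. *)
Lemma bounded_mean_cvg (f_ : nat -> T -> R) (f : T -> R) (M : R) :
  (forall n, measurable_fun [set: T] (f_ n)) ->
  (forall n w, `|f_ n w| <= M) ->
  (forall w, f_ n w @[n --> \oo] --> f w) ->
  mean P (f_ n) @[n --> \oo] --> mean P f.
Proof.
move=> mf_ f_M f_f.
have mf : measurable_fun [set: T] f.
  by apply: (measurable_fun_cvg mf_) => w _; exact: f_f.
have [|||||/Lfun1_integrable fint _ +] :=
  @dominated_convergence _ _ _ P setT measurableT
  (fun n => EFin \o f_ n) (EFin \o f) (cst M%:E).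
- by move=> n; exact/measurable_EFinP.
- exact/measurable_EFinP.
- by apply/aeW => w _; apply: cvg_EFin; [exact: nearW | exact: f_f].
- exact: finite_measure_integrable_cst.
- by apply/aeW => w n _ /=; rewrite lee_fin.
have := expectation_fin_num fint.
rewrite /mean unlock => finf cv.
by apply: fine_cvg; rewrite fineK.
Qed.

End mean_theory.

(** * Characteristic functions determine distribution functions *)

Section equality_in_law.
Context {R : realType} {dT dS : measure_display}.
Context {T : measurableType dT} {S : measurableType dS}.
Variables (P : probability T R) (Q : probability S R).
Variables (Y : {RV P >-> R}) (X : {RV Q >-> R}).
Implicit Types (f g : R -> R).

(** The test functions that do not separate the laws of [Y] and [X]. Measurability and boundedness
    are part of the class so that it is stable under linear combinations and bounded limits without
    side conditions. *)
Definition equal_mean f : Prop :=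
  [/\ measurable_fun [set: R] f, exists M, forall x, `|f x| <= M
    & mean P (f \o Y) = mean Q (f \o X)].

Lemma equal_mean_Lfun1 f : equal_mean f ->
  (f \o Y) \in Lfun P 1 /\ (f \o X) \in Lfun Q 1.
Proof.
case=> mf [M fM] _; split; apply: (@bounded_Lfun1 _ _ _ _ _ M) => [|w];
  by [exact: measurableT_comp | exact: fM].
Qed.

Lemma equal_meanD f g : equal_mean f -> equal_mean g ->
  equal_mean (fun x => f x + g x).
Proof.
move=> ef eg; have [fP fQ] := equal_mean_Lfun1 ef.
have [gP gQ] := equal_mean_Lfun1 eg.
case: ef eg => mf [M fM] eqf [mg [N gN] eqg]; split.
- exact: measurable_funD.
- by exists (M + N) => x; rewrite (le_trans (ler_normD _ _))// lerD.
- by rewrite [LHS]meanD// [RHS]meanD// eqf eqg.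
Qed.

Lemma equal_meanZ a f : equal_mean f -> equal_mean (fun x => a * f x).
Proof.
move=> ef; have [fP fQ] := equal_mean_Lfun1 ef.
case: ef => mf [M fM] eqf; split.
- exact: measurable_funM.
- by exists (`|a| * M) => x; rewrite normrM ler_wpM2l.
- by rewrite [LHS]meanZ// [RHS]meanZ// eqf.
Qed.

Lemma equal_mean_cvg (f_ : nat -> R -> R) f (M : R) :
  (forall n, equal_mean (f_ n)) -> (forall n x, `|f_ n x| <= M) ->
  (forall x, f_ n x @[n --> \oo] --> f x) -> equal_mean f.
Proof.
move=> ef f_M f_f; split.
- by apply: (@measurable_fun_cvg _ _ _ _ f_) => [n|x _]; [case: (ef n) | exact: f_f].
- exists M => x; have fx : `|f_ n x| @[n --> \oo] --> `|f x| by apply: cvg_norm; exact: f_f.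
  rewrite -(cvg_lim (@Rhausdorff R) fx).
  by apply: limr_le; [apply/cvg_ex; exists `|f x| | exact: nearW].
- have cP : mean P (f_ n \o Y) @[n --> \oo] --> mean P (f \o Y).
    apply: (@bounded_mean_cvg _ _ _ _ _ _ M) => [n|n w|w] //=.
    by apply: measurableT_comp => //; case: (ef n).
  have cQ : mean Q (f_ n \o X) @[n --> \oo] --> mean Q (f \o X).
    apply: (@bounded_mean_cvg _ _ _ _ _ _ M) => [n|n w|w] //=.
    by apply: measurableT_comp => //; case: (ef n).
  have PQ : (fun n => mean P (f_ n \o Y)) = (fun n => mean Q (f_ n \o X)).
    by apply/funext => n; case: (ef n).
  by move: cP; rewrite PQ => cP; exact: (cvg_unique (@Rhausdorff R) cP cQ).
Qed.


(** The free phase [b] makes cosines sufficient as generators: a sine is a cosine shifted by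
    [pi / 2]. *)
Inductive trig_poly : (R -> R) -> Prop :=
| trig_cos s b : trig_poly (fun x => cos (s * x + b))
| trigD f g : trig_poly f -> trig_poly g -> trig_poly (fun x => f x + g x)
| trigZ a f : trig_poly f -> trig_poly (fun x => a * f x).

Lemma trig_cst a : trig_poly (fun=> a).
Proof.
rewrite (_ : (fun=> a) = (fun x => a * cos (0 * x + 0))); last first.
  by apply/funext => x; rewrite mul0r addr0 cos0 mulr1.
exact/trigZ/trig_cos.
Qed.

(** Induction on both factors reduces to two cosines, whose product is half the sum of the cosines
    of the sum and of the difference of the arguments. *)
Lemma trigM f g : trig_poly f -> trig_poly g -> trig_poly (fun x => f x * g x).
Proof.
move=> tf; elim: tf g => [s b|f1 f2 _ IH1 _ IH2|a f1 _ IH] g tg.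
- elim: tg => [t c|g1 g2 _ IH1 _ IH2|a g1 _ IH].
  + rewrite (_ : (fun _ => _) = fun x =>
      2^-1 * (cos ((s + t) * x + (b + c)) + cos ((s - t) * x + (b - c)))).
      by apply/trigZ/trigD; exact: trig_cos.
    apply/funext => x.
    rewrite (_ : (s + t) * x + (b + c) = (s * x + b) + (t * x + c)); last by ring.
    rewrite (_ : (s - t) * x + (b - c) = (s * x + b) - (t * x + c)); last by ring.
    by rewrite (cosD (s * x + b)) (cosB (s * x + b)); field.
  + by under eq_fun do rewrite mulrDr; exact: trigD.
  + by under eq_fun do rewrite mulrCA; exact: trigZ.
- by under eq_fun do rewrite mulrDl; apply: trigD; [exact: IH1 | exact: IH2].
- by under eq_fun do rewrite -mulrA; apply: trigZ; exact: IH.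
Qed.

Lemma trigX f n : trig_poly f -> trig_poly (fun x => f x ^+ n).
Proof.
move=> tf; elim: n => [|n IH]; first exact: trig_cst.
by under eq_fun do rewrite exprS; exact: trigM.
Qed.

Hypothesis eq_char_fun : forall s, char_fun_real P Y s = char_fun_real Q X s.

Lemma equal_mean_cos s : equal_mean (fun x => cos (s * x)).
Proof.
split.
- apply: measurableT_comp => //.
  by apply: continuous_measurable_fun; exact: continuous_cos.
- by exists 1 => x; exact: cos_max.
- by have := eq_char_fun s => -[].
Qed.

Lemma equal_mean_sin s : equal_mean (fun x => sin (s * x)).
Proof.
split.
- apply: measurableT_comp => //.
  by apply: continuous_measurable_fun; exact: continuous_sin.
- by exists 1 => x; exact: sin_max.
- by have := eq_char_fun s => -[].
Qed.

Lemma equal_mean_trig f : trig_poly f -> equal_mean f.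
Proof.
elim=> [s b|f1 f2 _ IH1 _ IH2|a f1 _ IH].
- rewrite (_ : (fun _ => _) =
    fun x => cos b * cos (s * x) + (- sin b) * sin (s * x)); last first.
    by apply/funext => x; rewrite cosD; ring.
  apply: equal_meanD; apply: equal_meanZ; first exact: equal_mean_cos.
  exact: equal_mean_sin.
- exact: equal_meanD.
- exact: equal_meanZ.
Qed.

End equality_in_law.

(** * Polynomials converging pointwise on [0, 1] to the indicator of [0, 1/2) *)

Section step_approximation.
Context {R : realType}.
Implicit Types (x q : R) (n : nat).

(* The exponent [n * 2 ^ n] (rather than the usual [2 ^ n]) makes the limit
   equal to 0 also at the threshold [1 / 2]. *)
Definition step_approx n x : R := (1 - x ^+ n) ^+ (n * 2 ^ n).

Lemma step_approx_itv n x : 0 <= x <= 1 -> 0 <= step_approx n x <= 1.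
Proof.
move=> /andP[x0 x1]; have xn0 : 0 <= x ^+ n by rewrite exprn_ge0.
have xn1 : x ^+ n <= 1 by rewrite exprn_ile1.
by rewrite /step_approx exprn_ge0 ?subr_ge0// exprn_ile1 ?subr_ge0// lerBlDr lerDl.
Qed.

Lemma bernoulli_ge n x : -1 <= x -> 1 + n%:R * x <= (1 + x) ^+ n.
Proof.
move=> x1; elim: n => [|n IH]; first by rewrite mul0r addr0 expr0.
have x1' : 0 <= 1 + x by lra.
rewrite exprS (le_trans _ (ler_wpM2l x1' IH))// -natr1.
have : 0 <= n%:R * x ^+ 2 :> R by rewrite mulr_ge0// sqr_ge0.
by rewrite expr2; nra.
Qed.

(** Write [q = r ^+ 2]. Bernoulli applied to [r^-1 = 1 + h] bounds [n * r ^+ n] by [h^-1], and the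
    remaining factor [r ^+ n] tends to 0. *)
Lemma cvg_natM_expr q : 0 <= q < 1 -> n%:R * q ^+ n @[n --> \oo] --> (0 : R).
Proof.
move=> /andP[q0 q1]; pose r := Num.sqrt q.
have qE : q = r ^+ 2 by rewrite sqr_sqrtr.
have r0 : 0 <= r by rewrite sqrtr_ge0.
have r1 : r < 1 by rewrite -sqrtr1 ltr_sqrt.
have [r_eq0|rn0] := eqVneq r 0.
  rewrite (_ : (fun _ => _) = cst 0); first exact: cvg_cst.
  apply/funext => n /=; rewrite qE r_eq0 expr2 mulr0.
  by case: n => [|n]; rewrite ?mul0r// expr0n mulr0.
have rp : 0 < r by rewrite lt_neqAle eq_sym rn0.
have rV1 : 1 < r^-1 by rewrite invf_gt1.
pose h := r^-1 - 1.
have h0 : 0 < h by rewrite subr_gt0.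
have nr n : n%:R * r ^+ n <= h^-1.
  have hn1 : -1 <= h by lra.
  have := bernoulli_ge n hn1; rewrite {2}/h (addrC 1 (_ - 1)) subrK exprVn => le1.
  rewrite -(ler_pM2r h0) mulVf ?gt_eqF// mulrAC -ler_pdivlMr ?exprn_gt0// div1r.
  by lra.
have hr : h^-1 * r ^+ n @[n --> \oo] --> (0 : R).
  by apply: cvg_geometric; rewrite ger0_norm.
apply: (@squeeze_cvgr _ _ _ _ (fun=> 0) (fun n => h^-1 * r ^+ n)) => //.
- apply: nearW => n; rewrite mulr_ge0 ?exprn_ge0//= qE -exprM mul2n -addnn exprD.
  by rewrite mulrA ler_wpM2r ?exprn_ge0.
- exact: cvg_cst.
Qed.

Lemma step_approx_lt x : 0 <= x -> x < 2^-1 ->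
  step_approx n x @[n --> \oo] --> (1 : R).
Proof.
move=> x0 x12.
(* This is the Bernoulli lower bound of [step_approx n x]; it tends to 1 because [2 * x < 1]. *)
have c : 1 - n%:R * (2 * x) ^+ n @[n --> \oo] --> (1 : R).
  rewrite -[X in _ --> X]subr0; apply: cvgB; first exact: cvg_cst.
  by apply: cvg_natM_expr; apply/andP; split; lra.
have x1 : 0 <= x <= 1 by lra.
apply: (@squeeze_cvgr _ _ _ _ (fun n => 1 - n%:R * (2 * x) ^+ n) (fun=> 1)) => //.
- apply: nearW => n; case/andP: (step_approx_itv n x1) => _ ->; rewrite andbT.
  have xn1 : -1 <= - x ^+ n by rewrite lerN2 exprn_ile1//; lra.
  apply: le_trans (bernoulli_ge _ xn1).
  by rewrite natrM natrX exprMn mulrN mulrA.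
- exact: cvg_cst.
Qed.

(** With N = n 2^n, the product of (1 - x^n)^N and (1 + x^n)^N is at most 1. By Bernoulli the second
    factor is at least 1 + n (2x)^n, hence at least n + 1 since 2x >= 1. So the first is at most 1 /
    (n + 1). *)
Lemma step_approx_ge x : 2^-1 <= x -> x <= 1 ->
  step_approx n x @[n --> \oo] --> (0 : R).
Proof.
move=> x12 x1; have x01 : 0 <= x <= 1 by lra.
apply: (@squeeze_cvgr _ _ _ _ (fun=> 0) harmonic) => //.
- apply: nearW => n; case/andP: (step_approx_itv n x01) => -> _ /=.
  have xn0 : 0 <= x ^+ n by rewrite exprn_ge0//; lra.
  have xn1 : x ^+ n <= 1 by rewrite exprn_ile1//; lra.
  have xnN1 : -1 <= x ^+ n by lra.
  have ge1n : n.+1%:R <= (1 + x ^+ n) ^+ (n * 2 ^ n).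
    apply: le_trans (bernoulli_ge _ xnN1).
    rewrite natrM natrX -mulrA -exprMn -natr1 addrC lerD2l ler_peMr//.
    by rewrite exprn_ege1//; lra.
  have n0 : 0 < n.+1%:R :> R by [].
  rewrite /harmonic /= -[leRHS]mul1r ler_pdivlMr//.
  apply: le_trans (ler_wpM2l _ ge1n) _; first by case/andP: (step_approx_itv n x01).
  rewrite /step_approx -exprMn exprn_ile1//; nra.
- exact: cvg_cst.
- exact: cvg_harmonic.
Qed.

End step_approximation.

(** * From trigonometric polynomials to half-lines *)

Section uniqueness.
Context {R : realType} {dT dS : measure_display}.
Context {T : measurableType dT} {S : measurableType dS}.
Variables (P : probability T R) (Q : probability S R).
Variables (Y : {RV P >-> R}) (X : {RV Q >-> R}).
Hypothesis eq_char_fun : forall s, char_fun_real P Y s = char_fun_real Q X s.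

Lemma equal_mean_sin_lt0 a s :
  equal_mean Y X (fun y => (sin (s * (a - y)) < 0)%R%:R : R).
Proof.
pose g y := (1 + sin (s * (a - y))) / 2.
have g01 y : 0 <= g y <= 1.
  by have := sin_geN1 (s * (a - y)); have := sin_le1 (s * (a - y)); rewrite /g; lra.
apply: (@equal_mean_cvg _ _ _ _ _ _ _ _ _ (fun n y => step_approx n (g y)) _ 1).
- move=> n; apply: (equal_mean_trig eq_char_fun).
  apply: (@trigX _ (fun y => 1 - g y ^+ n)).
  rewrite (_ : (fun _ => _) = fun y => 1 + (- 1) * g y ^+ n); last first.
    by apply/funext => y; rewrite mulN1r.
  apply: trigD; [exact: trig_cst | apply/trigZ/trigX].
  (* The shift by [pi / 2] turns the sine into one of the generating cosines. *)
  rewrite (_ : g = fun y => 2^-1 * (1 + cos ((- s) * y + (s * a - pi / 2)))).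
    by apply/trigZ/trigD; [exact: trig_cst | exact: trig_cos].
  apply/funext => y; rewrite /g addrA cosBpihalf mulrC.
  by congr (_ * (_ + sin _)); ring.
- move=> n y; case/andP: (step_approx_itv n (g01 y)) => ge0 le1.
  by rewrite ger0_norm.
(* [g y < 1/2] holds exactly when the sine is negative; a zero of the sine falls on the threshold
   1/2, where the limit is 0. *)
- move=> y; have [lt0|ge0] := ltP (sin (s * (a - y))) 0.
    by apply: step_approx_lt; have := g01 y; rewrite /g; lra.
  by apply: step_approx_ge; have := g01 y; rewrite /g; lra.
Qed.

(** Lowering the frequency removes the periodicity: for fixed [y] and large [k] the argument of the
    sine lies in (-2, 2), where the sine has the sign of its argument. *)
Lemma equal_mean_gt a : equal_mean Y X (fun y => (a < y)%R%:R : R).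
Proof.
apply: (@equal_mean_cvg _ _ _ _ _ _ _ _ _
  (fun k y => (sin (k.+1%:R^-1 * (a - y)) < 0)%R%:R) _ 1).
- by move=> k; exact: equal_mean_sin_lt0.
- by move=> k y; case: (_ < _); rewrite ?normr1 ?normr0.
move=> y; apply: cvg_near_cst.
near=> k.
have k0 : 0 < k.+1%:R^-1 :> R by rewrite invr_gt0.
have small : k.+1%:R^-1 * `|a - y| < 2.
  rewrite mulrC ltr_pdivrMr// -natr1.
  suff : `|a - y| < k%:R by have : 0 <= k%:R :> R by []; lra.
  by near: k; exact: nbhs_infty_gtr.
have [ay|ya|->] := ltgtP a y.
- rewrite -(opprB y a) mulrN sinN oppr_lt0 sin2_gt0//.
  by move: small; rewrite distrC gtr0_norm ?subr_gt0// => ->; rewrite mulr_gt0// subr_gt0.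
- rewrite ltNge ltW// sin2_gt0//.
  by move: small; rewrite gtr0_norm ?subr_gt0// => ->; rewrite mulr_gt0// subr_gt0.
- by rewrite subrr mulr0 sin0 ltxx.
Unshelve. all: by end_near. Qed.

Lemma char_fun_cdf a : cdf Y a = cdf X a.
Proof.
have [_ _ eqm] := equal_mean_gt a.
have ccdfE d (V : measurableType d) (p : probability V R) (Z : {RV p >-> R}) :
    ccdf Z a = (mean p ((fun y => (a < y)%R%:R) \o Z))%:E.
  have mZ : measurable (Z @^-1` `]a, +oo[)
    by rewrite -[X in measurable X]setTI; exact: measurable_funP.
  rewrite /mean (_ : _ \o _ = \1_(Z @^-1` `]a, +oo[)).
    by rewrite expectation_indic// fineK// fin_num_measure.
  apply/funext => w; rewrite indicE /=; congr (nat_of_bool _)%:R.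
  by apply/idP/idP; rewrite inE /= in_itv /= andbT.
by rewrite !cdf_1_ccdf !ccdfE eqm.
Qed.

End uniqueness.

(** * Moments of complex random vectors *)

Section complex_parts.
Local Open Scope complex_scope.
Local Open Scope sesquilinear_scope.
Context {R : realType}.
Implicit Types x y : R[i].

Lemma cReD x y : complex.Re (x + y) = complex.Re x + complex.Re y.
Proof. by case: x y => [? ?] []. Qed.

Lemma cImD x y : complex.Im (x + y) = complex.Im x + complex.Im y.
Proof. by case: x y => [? ?] []. Qed.

Lemma cReM x y :
  complex.Re (x * y) = complex.Re x * complex.Re y - complex.Im x * complex.Im y.
Proof. by case: x y => [? ?] []. Qed.

Lemma cImM x y :
  complex.Im (x * y) = complex.Re x * complex.Im y + complex.Im x * complex.Re y.
Proof. by case: x y => [? ?] []. Qed.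

Lemma cRe_conj x : complex.Re (Num.conj x) = complex.Re x.
Proof. by case: x. Qed.

Lemma cIm_conj x : complex.Im (Num.conj x) = - complex.Im x.
Proof. by case: x. Qed.

Lemma cRe_sum (I : Type) (r : seq I) (F : I -> R[i]) :
  complex.Re (\sum_(i <- r) F i) = \sum_(i <- r) complex.Re (F i).
Proof. exact: (big_morph _ cReD). Qed.

End complex_parts.

Section complex_expectation.
Local Open Scope complex_scope.
Local Open Scope sesquilinear_scope.
Context {R : realType} {dT : measure_display} {T : measurableType dT}.
Variable P : probability T R.
Implicit Types (Z W : T -> R[i]).

Definition cintegrable Z : Prop :=
  (fun w => complex.Re (Z w)) \in Lfun P 1 /\
  (fun w => complex.Im (Z w)) \in Lfun P 1.

Lemma cexpectationE Z : cexpectation P Z =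
  mean P (fun w => complex.Re (Z w)) +i* mean P (fun w => complex.Im (Z w)).
Proof. by []. Qed.

Lemma cintegrableD Z W : cintegrable Z -> cintegrable W ->
  cintegrable (fun w => Z w + W w).
Proof.
move=> [Z1 Z2] [W1 W2]; split.
  by under eq_fun do rewrite cReD; exact: Lfun1D.
by under eq_fun do rewrite cImD; exact: Lfun1D.
Qed.

Lemma cintegrableZ a Z : cintegrable Z -> cintegrable (fun w => a * Z w).
Proof.
move=> [Z1 Z2]; split.
  under eq_fun do rewrite cReM -mulNr.
  by apply: Lfun1D; exact: Lfun1Z.
under eq_fun do rewrite cImM.
by apply: Lfun1D; exact: Lfun1Z.
Qed.

Lemma cexpectationD Z W : cintegrable Z -> cintegrable W ->
  cexpectation P (fun w => Z w + W w) = cexpectation P Z + cexpectation P W.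
Proof.
move=> [Z1 Z2] [W1 W2]; rewrite !cexpectationE.
under eq_fun do rewrite cReD.
under [X in _ +i* mean P X = _]eq_fun do rewrite cImD.
by rewrite !meanD.
Qed.

Lemma cexpectationZ a Z : cintegrable Z ->
  cexpectation P (fun w => a * Z w) = a * cexpectation P Z.
Proof.
move=> [Z1 Z2]; rewrite !cexpectationE.
under eq_fun do rewrite cReM -mulNr.
under [X in _ +i* mean P X = _]eq_fun do rewrite cImM.
rewrite !meanD ?Lfun1Z// !meanZ//; case: a => a b /=.
by apply/eqP; rewrite eq_complex /= mulNr !eqxx.
Qed.

Lemma cexpectation_sum (I : Type) (r : seq I) (F : I -> T -> R[i]) :
  (forall i, cintegrable (F i)) ->
  cintegrable (fun w => \sum_(i <- r) F i w) /\
  cexpectation P (fun w => \sum_(i <- r) F i w) =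
    \sum_(i <- r) cexpectation P (F i).
Proof.
move=> F1; elim: r => [|i r [IH1 IH2]].
  under eq_fun do rewrite big_nil.
  rewrite big_nil cexpectationE /= !mean_cst; split=> //.
  by split; exact: Lfun_cst1.
under eq_fun do rewrite big_cons.
by rewrite big_cons cexpectationD// IH2; split=> //; exact: cintegrableD.
Qed.

Definition csquare_integrable Z : Prop :=
  (fun w => complex.Re (Z w)) \in Lfun P 2%:E /\
  (fun w => complex.Im (Z w)) \in Lfun P 2%:E.

Lemma csquare_integrable_int Z : csquare_integrable Z -> cintegrable Z.
Proof. by case=> *; split; exact: Lfun2_Lfun1. Qed.

Lemma csquare_integrable_conj Z :
  csquare_integrable Z -> csquare_integrable (fun w => Num.conj (Z w)).
Proof.
case=> Z1 Z2; split; first by under eq_fun do rewrite cRe_conj.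
by under eq_fun do rewrite cIm_conj -mulN1r; exact: Lfun2Z.
Qed.

Lemma csquare_integrableB Z a :
  csquare_integrable Z -> csquare_integrable (fun w => Z w - a).
Proof.
case=> Z1 Z2; split.
  by under eq_fun do rewrite cReD; apply: Lfun2D => //; exact: Lfun_cst.
by under eq_fun do rewrite cImD; apply: Lfun2D => //; exact: Lfun_cst.
Qed.

Lemma csquare_integrableM Z W : csquare_integrable Z -> csquare_integrable W ->
  cintegrable (fun w => Z w * W w).
Proof.
move=> [Z1 Z2] [W1 W2]; split.
  under eq_fun do rewrite cReM -mulN1r.
  by apply: Lfun1D; [|apply: Lfun1Z]; exact: Lfun2_mul_Lfun1.
under eq_fun do rewrite cImM.
by apply: Lfun1D; exact: Lfun2_mul_Lfun1.
Qed.

End complex_expectation.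

(** * Mean and variance of Re(u^H d) *)

Section second_order_moments.
Local Open Scope complex_scope.
Local Open Scope sesquilinear_scope.
Context {R : realType} {dT : measure_display} {T : measurableType dT}.
Variable P : probability T R.
Context {N : nat} (d : T -> 'cV[R[i]]_N) (u : 'cV[R[i]]_N).
Hypothesis d2 : L2_vector P d.

Let mu := mean_vector P d.
Let e j w : R[i] := d w j 0 - mu j 0.

Let e2 j : csquare_integrable P (e j).
Proof. exact/csquare_integrableB/d2. Qed.

Lemma innerE (v : 'cV[R[i]]_N) :
  (u ^t* *m v) 0 0 = \sum_j Num.conj (u j 0) * v j 0.
Proof. by rewrite !mxE; apply: eq_bigr => j _; rewrite !mxE. Qed.

Definition re_inner w : R := complex.Re ((u ^t* *m d w) 0 0).

Lemma re_inner_Lfun2 : re_inner \in Lfun P 2%:E.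
Proof.
rewrite (_ : re_inner = fun w => \sum_j
  (complex.Re (u j 0) * complex.Re (d w j 0) +
   complex.Im (u j 0) * complex.Im (d w j 0))); last first.
  apply/funext => w; rewrite /re_inner innerE cRe_sum; apply: eq_bigr => j _.
  by rewrite cReM cRe_conj cIm_conj mulNr opprK.
elim: (index_enum _) => [|j r IH].
  by under eq_fun do rewrite big_nil; exact: Lfun_cst.
under eq_fun do rewrite big_cons.
by apply: Lfun2D => //; have [? ?] := d2 j; apply: Lfun2D; exact: Lfun2Z.
Qed.

Lemma mean_re_inner : mean P re_inner = complex.Re ((u ^t* *m mu) 0 0).
Proof.
rewrite innerE; under eq_bigr do rewrite mxE.
have d1 j : cintegrable P (fun w => d w j 0).
  exact/csquare_integrable_int/d2.
under eq_bigr => j _ do rewrite -cexpectationZ//.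
have [_ <-] := cexpectation_sum (index_enum 'I_N)
  (fun j => cintegrableZ (Num.conj (u j 0)) (d1 j)).
rewrite cexpectationE /=; congr mean; apply/funext => w.
by rewrite /re_inner innerE.
Qed.

(** Put a = u^H (d - mu). The two forms are E[a conj(a)] and Re E[a^2], and Re(a (conj(a) + a)) = 2
    (Re a)^2, where Re a is the centred [re_inner]. *)
Lemma re_inner_quadratic :
  complex.Re ((u ^t* *m covariance_matrix P d *m u) 0 0) +
  complex.Re ((u ^t* *m pseudo_covariance_matrix P d *m map_mx Num.conj u) 0 0)
  = 2 * std_dev P re_inner ^+ 2.
Proof.
(* The terms of the double sum a (conj(a) + a), with [k] the row and [j] the column index, in the
   order in which the matrix products expand. *)
pose F j k w := Num.conj (u k 0) * u j 0 * (e k w * Num.conj (e j w)) +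
  Num.conj (u k 0) * Num.conj (u j 0) * (e k w * e j w).
have F1 j k : cintegrable P (F j k).
  apply: cintegrableD; apply: cintegrableZ; apply: csquare_integrableM => //.
  exact: csquare_integrable_conj.
have Fs j : cintegrable P (fun w => \sum_k F j k w).
  by have [] := cexpectation_sum (index_enum 'I_N) (F1 j).
rewrite -cReD.
transitivity (complex.Re (cexpectation P (fun w => \sum_j \sum_k F j k w))).
  have [_ ->] := cexpectation_sum (index_enum 'I_N) Fs.
  congr complex.Re; rewrite !mxE -big_split; apply: eq_bigr => j _ /=.
  have [_ ->] := cexpectation_sum (index_enum 'I_N) (F1 j).
  rewrite !mxE !mulr_suml -big_split; apply: eq_bigr => k _ /=.
  have c1 : cintegrable P (fun w => e k w * Num.conj (e j w)).
    by apply: csquare_integrableM => //; exact: csquare_integrable_conj.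
  have c2 : cintegrable P (fun w => e k w * e j w) by exact: csquare_integrableM.
  rewrite cexpectationD; [|exact: cintegrableZ..].
  rewrite !cexpectationZ// !mxE (mulrAC _ (u j 0)) (mulrAC _ (Num.conj (u j 0))).
  by congr (_ * _ * _ + _ * _ * _); apply: (congr1 (cexpectation P)); apply/funext => w;
    rewrite /e /mu !mxE big_ord1 !mxE.
have -> : std_dev P re_inner ^+ 2 = mean P (fun w => (re_inner w - mean P re_inner) ^+ 2).
  by rewrite sqr_sqrtr ?fine_ge0 ?variance_ge0// /variance unlock.
have c2 : (fun w => re_inner w - mean P re_inner) \in Lfun P 2%:E.
  by apply: Lfun2D; [exact: re_inner_Lfun2 | exact: Lfun_cst].
rewrite -meanZ; last exact: Lfun2_mul_Lfun1.
rewrite cexpectationE /=; congr mean; apply/funext => w.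
pose a := \sum_j Num.conj (u j 0) * e j w.
have -> : \sum_j \sum_k F j k w = a * (Num.conj a + a).
  rewrite mulrDr mulrC /a rmorph_sum /= !big_distrlr /= -big_split /=.
  apply: eq_bigr => j _; rewrite -big_split /=; apply: eq_bigr => k _.
  by rewrite rmorphM /= conjCK /F; ring.
have -> : re_inner w - mean P re_inner = complex.Re a.
  rewrite /= mean_re_inner /re_inner !innerE !cRe_sum -sumrB; apply: eq_bigr => j _.
  by rewrite -[RHS]/(complex.Re (_ * _)) /e mulrBr [in RHS]cReD; case: (_ * mu j 0).
by rewrite cReM cReD cImD cRe_conj cIm_conj; ring.
Qed.

End second_order_moments.

(** * Quantiles and chance constraints *)

Section quantile_theory.
Local Open Scope complex_scope.
Local Open Scope sesquilinear_scope.
Context {R : realType} {dS : measure_display} {S : measurableType dS}.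
Variables (Q : probability S R) (X : {RV Q >-> R}).

(** The limits 0 and 1 of the distribution function at the infinities make the set below nonempty
    and bounded below, so that its [inf] is meaningful; right continuity shows that the infimum is
    attained. *)
Lemma le_quantile (p x : R) : 0 < p < 1 ->
  (p%:E <= cdf X x)%E <-> quantile (cdf X) p <= x.
Proof.
move=> /andP[p0 p1]; pose A := [set y : R | (p%:E <= cdf X y)%E].
have lbA : has_lbound A.
  have [M [_ MP]] : \forall y \near -oo%R, (cdf X y < p%:E)%E.
    by apply: (@cvg_cdfNy0 _ _ _ Q X [set e | (e < p%:E)%E]); exact: open_ereal_lt'.
  exists (M - 1) => y Ay; rewrite leNgt; apply/negP => yM.
  have : (cdf X y < p%:E)%E by apply: MP; lra.
  by rewrite ltNge Ay.
have A0 : A !=set0.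
  have [M [_ MP]] : \forall y \near +oo%R, (p%:E < cdf X y)%E.
    by apply: (@cvg_cdfy1 _ _ _ Q X [set e | (p%:E < e)%E]); exact: open_ereal_gt'.
  by exists (M + 1); apply/ltW/MP; lra.
split=> [px|qx]; first exact: ge_inf.
apply: (cvge_ge _ (@cdf_right_continuous _ _ _ _ X x)).
near=> y; have xy : x < y by near: y; exact: nbhs_right_gt.
have [z Az zy] := inf_lt A0 (le_lt_trans qx xy).
by rewrite (le_trans Az)// cdf_nondecreasing// ltW.
Unshelve. all: by end_near. Qed.

End quantile_theory.

(** * The law of Re(u^H d) and its chance constraint *)

Section affine_law.
Local Open Scope complex_scope.
Local Open Scope sesquilinear_scope.
Context {R : realType} {dT dS : measure_display}.
Context {T : measurableType dT} {S : measurableType dS}.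
Variables (P : probability T R) (Q : probability S R).

Lemma expiD (x y : R) : expi (x + y) = expi x * expi y.
Proof.
by rewrite /expi cosD sinD; apply/eqP; rewrite eq_complex /= !eqxx /= addrC eqxx.
Qed.

Lemma char_fun_real_affine (X : {RV Q >-> R}) (m sg s : R) :
  char_fun_real Q (fun x => m + sg * X x) s =
    expi (s * m) * char_fun_real Q X (s * sg).
Proof.
rewrite /char_fun_real -cexpectationZ.
  apply: (congr1 (cexpectation Q)); apply/funext => x.
  by rewrite -expiD; congr expi; ring.
have mX : measurable_fun [set: S] (fun x => s * sg * X x).
  by apply: measurable_funM.
split; apply: (@bounded_Lfun1 _ _ _ _ _ 1) => [|w] /=.
- by apply: (measurableT_comp _ mX); apply: continuous_measurable_fun; exact: continuous_cos.
- exact: cos_max.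
- by apply: (measurableT_comp _ mX); apply: continuous_measurable_fun; exact: continuous_sin.
- exact: sin_max.
Qed.

Context {N : nat} (psi : R -> R[i]) (d : T -> 'cV[R[i]]_N) (u : 'cV[R[i]]_N).
Hypothesis hd : CES P psi d.
Variable X : {RV Q >-> R}.
Hypothesis hX : standard_elliptical psi X.

Lemma re_innerZ (s : R) : re_inner d (s%:C *: u) = fun w => s * re_inner d u w.
Proof.
apply/funext => w; rewrite /re_inner !innerE !cRe_sum mulr_sumr; apply: eq_bigr => j _.
by rewrite mxE !cReM !cRe_conj !cIm_conj cReM cImM /=; ring.
Qed.

(** The CES identity is taken at the vector s u: its quadratic form is 2 Var(s Re(u^H d)) = 2 (s
    sigma)^2, the argument of [psi] in the standard law at s sigma. *)
Lemma CES_char_fun_re_inner (s : R) :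
  char_fun_real P (re_inner d u) s =
  char_fun_real Q (fun x => mean P (re_inner d u) + std_dev P (re_inner d u) * X x) s.
Proof.
case: hd => d2 /(_ (s%:C *: u)); rewrite re_inner_quadratic//.
rewrite -[X in expi X](@mean_re_inner _ _ _ P _ d)//.
rewrite /char_fun_vector -/(re_inner d _) => hs.
rewrite char_fun_real_affine hX.
have -> : char_fun_real P (re_inner d u) s =
    cexpectation P (fun w => expi (re_inner d (s%:C *: u) w)) by rewrite re_innerZ.
rewrite [LHS]hs re_innerZ meanZ; last exact/Lfun2_Lfun1/re_inner_Lfun2.
congr (_ * psi (2 * _)).
have V := varianceZ s (re_inner_Lfun2 u d2).
rewrite exprMn !sqr_sqrtr ?fine_ge0 ?variance_ge0//.
rewrite (_ : (fun _ => _) = s \o* re_inner d u) ?V.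
  by rewrite fineM// variance_fin_num// re_inner_Lfun2.
by apply/funext => w /=; rewrite mulrC.
Qed.

Lemma CES_chance_constraint (p t : R) : 0 < p < 1 ->
  (p%:E <= P [set w | (re_inner d u w <= t)%R])%E <->
  mean P (re_inner d u) + quantile (cdf X) p * std_dev P (re_inner d u) <= t.
Proof.
move=> p01; set m := mean P _; set sg := std_dev P _.
have mY : re_inner d u \in mfun by apply: sub_Lfun_mfun (re_inner_Lfun2 u hd.1).
pose Y : {RV P >-> R} := mfun_Sub mY.
have mZ : (fun x => m + sg * X x) \in mfun.
  by rewrite inE /=; apply: measurable_funD => //; exact: measurable_funM.
pose Z : {RV Q >-> R} := mfun_Sub mZ.
have -> : P [set w | (re_inner d u w <= t)%R] = Q [set x | (m + sg * X x <= t)%R].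
  have YZ s : char_fun_real P Y s = char_fun_real Q Z s.
    exact: CES_char_fun_re_inner.
  exact: (char_fun_cdf YZ t).
(* For sigma = 0 no standardization is possible; the probability is then 0 or 1, and [0 < p < 1]
   settles both cases. *)
have [sg0|sgn0] := eqVneq sg 0.
  rewrite sg0 mulr0 addr0; have [mt|tm] := leP m t.
    have -> : [set x | (m + 0 * X x <= t)%R] = setT.
      by apply/seteqP; split=> // x _ /=; rewrite mul0r addr0.
    by rewrite probability_setT lee_fin; split=> // _; lra.
  have -> : [set x | (m + 0 * X x <= t)%R] = set0.
    by apply/seteqP; split=> // x /=; rewrite mul0r addr0 leNgt tm.
  by rewrite measure0 lee_fin; split=> //; lra.
have sgp : 0 < sg by rewrite lt_neqAle eq_sym sgn0 sqrtr_ge0.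
rewrite (_ : [set x | _] = X @^-1` `]-oo, (t - m) / sg]).
  rewrite -[X in (_ <= X)%E]/(cdf X ((t - m) / sg)) le_quantile//.
  by rewrite ler_pdivlMr// lerBrDl.
by apply/seteqP; split=> x /=; rewrite in_itv /= ler_pdivlMr// lerBrDl mulrC.
Qed.

End affine_law.

(** * Symmetry of the standard law and sign of its quantiles *)

Section quantile_sign.
Local Open Scope complex_scope.
Local Open Scope sesquilinear_scope.
Context {R : realType} {dS : measure_display} {S : measurableType dS}.
Variables (Q : probability S R) (psi : R -> R[i]) (X : {RV Q >-> R}).
Hypothesis hX : standard_elliptical psi X.

(** The characteristic function is even in [s], so X and -X have the same law; for x < 0 the events
    X <= x and -X <= x are disjoint and equally likely. *)
Lemma standard_elliptical_cdf_neg (x : R) : x < 0 -> (cdf X x <= (2^-1)%:E)%E.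
Proof.
move=> x0; have mN : (fun w => 0 + (-1) * X w) \in mfun.
  by rewrite inE /=; apply: measurable_funD => //; exact: measurable_funM.
pose Z : {RV Q >-> R} := mfun_Sub mN.
have XZ s : char_fun_real Q X s = char_fun_real Q Z s.
  rewrite [RHS](char_fun_real_affine X 0 (-1) s) !hX mulr0 /expi cos0 sin0.
  by rewrite mulrN1 sqrrN mul1r.
have := char_fun_cdf XZ x; rewrite /cdf /distribution /pushforward /=.
set A := X @^-1` _; set B := _ @^-1` _ => AB.
have mA : measurable A by rewrite -[A]setTI /A; exact: measurable_funP.
have mB : measurable B by rewrite -[B]setTI; exact: (measurable_funP Z).
have AB0 : A `&` B = set0.
  apply/seteqP; split=> // w []; rewrite /A /B /= !in_itv /= add0r mulN1r => wx Nwx.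
  by move: wx Nwx; lra.
have {}AB : Q A = Q B by [].
have : (Q A + Q B <= 1)%E.
  by rewrite -measureU//; exact: probability_le1 (measurableU _ _ mA mB).
rewrite -AB -(fineK (fin_num_measure Q A mA)) -EFinD !lee_fin.
by lra.
Qed.

Lemma standard_elliptical_quantile_ge0 (p : R) : 2^-1 <= p < 1 ->
  (p = 2^-1 -> zero_unique_median (cdf X)) -> 0 <= quantile (cdf X) p.
Proof.
move=> /andP[p12 p1] med; rewrite leNgt; apply/negP => q0.
have p01 : 0 < p < 1 by lra.
have := (le_quantile X _ p01).2 (lexx (quantile (cdf X) p)).
apply/negP; rewrite -ltNge; have [pE|pn] := eqVneq p 2^-1.
  by rewrite {2}pE; exact: med.
rewrite (le_lt_trans (standard_elliptical_cdf_neg q0))// lte_fin.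
by rewrite lt_neqAle eq_sym pn.
Qed.

End quantile_sign.

(** * Second-order cone representation *)

Section gram_factorization.
Local Open Scope complex_scope.
Local Open Scope sesquilinear_scope.
Context {R : rcfType}.

(** Cholesky factorization by induction on the size: split off the first row and column and factor
    the Schur complement [C - c^T *m c]. *)
Lemma psd_factorization k (A : 'M[R]_k) :
  A^T = A -> (forall v : 'cV[R]_k, 0 <= (v^T *m A *m v) 0 0) ->
  exists M : 'M[R]_k, A = M^T *m M.
Proof.
elim: k A => [|k IH]; first by exists 0; rewrite [LHS]flatmx0 [RHS]flatmx0.
rewrite -[k.+1]/(1 + k)%N => A symA psdA.
have addE (M N : 'M[R]_1) : (M + N) 0 0 = M 0 0 + N 0 0 by rewrite mxE.
have scaleE x (M : 'M[R]_1) : (x *: M) 0 0 = x * M 0 0 by rewrite mxE.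
have oppE (M : 'M[R]_1) : (- M) 0 0 = - M 0 0 by rewrite mxE.
have trE (M : 'M[R]_1) : M^T 0 0 = M 0 0 by rewrite mxE.
pose a := ulsubmx A 0 0.
pose b := ursubmx A.
pose C := drsubmx A.
have AE : A = block_mx a%:M b b^T C.
  by rewrite -mx11_scalar trmx_ursub symA submxK.
have symC : C^T = C by rewrite trmx_drsub symA.
clearbody a b C.
have quadA (s : R) (v : 'cV[R]_k) :
    0 <= a * s ^+ 2 + 2 * s * (b *m v) 0 0 + (v^T *m C *m v) 0 0.
  have := psdA (col_mx s%:M v); rewrite AE tr_col_mx mul_row_block mul_row_col.
  rewrite !mulmxDl tr_scalar_mx !mul_scalar_mx -!scalemxAl !mul_mx_scalar.
  rewrite -trmx_mul !addE !scaleE trE.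
  by rewrite [a%:M 0 0]mxE eqxx mulr1n; lra.
have a0 : 0 <= a.
  by have := quadA 1 0; rewrite trmx0 !mulmx0 !mxE; lra.
(* If [r = 0], the convention [0^-1 = 0] gives [c = 0], and then [b = 0] as well. *)
pose r := Num.sqrt a; pose c := r^-1 *: b.
have rc : r *: c = b.
  rewrite scalerA; have [r0|rn0] := eqVneq r 0; last by rewrite divff// scale1r.
  rewrite r0 mul0r scale0r; apply/rowP => j; rewrite mxE.
  have a_eq0 : a = 0 by apply/eqP; rewrite eq_le a0 -sqrtr_eq0 andbT; exact/eqP.
  apply/esym/eqP/negPn/negP => bj0.
  (* With a = 0 and a nonzero [b 0 j], this choice of [s] gives the form the value -1. *)
  have := quadA (- ((C j j + 1) / (2 * b 0 j))) (delta_mx j 0).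
  rewrite trmx_delta -rowE -!colE !mxE a_eq0 mul0r add0r.
  rewrite (_ : 2 * _ * _ = - (C j j + 1)); first by lra.
  by field.
have rr : r ^+ 2 = a by rewrite sqr_sqrtr.
have [||M' M'E] := IH (C - c^T *m c).
- by rewrite linearB /= trmx_mul trmxK symC.
(* For nonzero [r] this [s] minimizes the form at fixed [v], and the minimum is the form of the
   Schur complement. *)
- move=> v; have := quadA (- r^-1 * (c *m v) 0 0) v.
  rewrite mulmxBr mulmxBl mulmxA -(mulmxA (v^T *m _)) -trmx_mul.
  have mulE (M N : 'M[R]_1) : (M *m N) 0 0 = M 0 0 * N 0 0 by rewrite mxE big_ord1.
  rewrite addE oppE mulE trE.
  rewrite -scalemxAl !scaleE -rr; set t := (b *m v) 0 0.
  have [->|rn0] := eqVneq r 0; first by rewrite invr0; lra.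
  rewrite (_ : r ^+ 2 * _ + _ = - (r^-1 * t * (r^-1 * t))); first by lra.
  by field.
exists (block_mx r%:M c 0 M' : 'M[R]_(1 + k)).
rewrite {1}AE (tr_block_mx (r%:M) c 0 M') mulmx_block trmx0 tr_scalar_mx.
rewrite !mul0mx !mulmx0 !addr0 -M'E subrKC -scalar_mxM -expr2 rr.
by rewrite mul_scalar_mx rc mul_mx_scalar -linearZ /= rc.
Qed.

End gram_factorization.

Section norm2_theory.
Local Open Scope complex_scope.
Local Open Scope sesquilinear_scope.
Context {R : realType}.

Lemma norm2_sqr r (v : 'cV[R]_r) : norm2 v ^+ 2 = (v^T *m v) 0 0.
Proof.
rewrite sqr_sqrtr; last by apply: sumr_ge0 => j _; exact: sqr_ge0.
by rewrite mxE; apply: eq_bigr => j _; rewrite mxE expr2.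
Qed.

Lemma norm2Z r a (v : 'cV[R]_r) : 0 <= a -> norm2 (a *: v) = a * norm2 v.
Proof.
move=> a0; rewrite -[in RHS](ger0_norm a0) -sqrtr_sqr -sqrtrM ?sqr_ge0// mulr_sumr.
by congr Num.sqrt; apply: eq_bigr => j _; rewrite mxE exprMn.
Qed.

End norm2_theory.

(** * Standard deviations as Euclidean norms *)

Section affine_families.
Local Open Scope complex_scope.
Local Open Scope sesquilinear_scope.
Context {R : realType} {dT : measure_display} {T : measurableType dT}.
Variable P : probability T R.

(** The left side is the quadratic form of the second-moment matrix of [V]; being a mean of squares
    it is nonnegative, so the matrix factors as M^T M. *)
Lemma mean_sqr_norm2 (N : nat) (V : 'I_N -> T -> R) :
  (forall k, V k \in Lfun P 2%:E) ->
  exists M : 'M[R]_N, forall y : 'cV[R]_N,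
    mean P (fun w => (\sum_k y k 0 * V k w) ^+ 2) = norm2 (M *m y) ^+ 2.
Proof.
move=> V2; pose A := \matrix_(k, l) mean P (fun w => V k w * V l w) : 'M[R]_N.
have VV1 k l : (fun w => V k w * V l w) \in Lfun P 1 by exact: Lfun2_mul_Lfun1.
have AE (y : 'cV[R]_N) :
    mean P (fun w => (\sum_k y k 0 * V k w) ^+ 2) = (y^T *m A *m y) 0 0.
  transitivity (mean P (fun w => \sum_l \sum_k y k 0 * y l 0 * (V k w * V l w))).
    apply: (congr1 (mean P)); apply/funext => w; rewrite expr2 big_distrlr exchange_big /=.
    by apply: eq_bigr => l _; apply: eq_bigr => k _; ring.
  have F1 l k : (fun w => y k 0 * y l 0 * (V k w * V l w)) \in Lfun P 1 by exact: Lfun1Z.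
  have Fs l : (fun w => \sum_k y k 0 * y l 0 * (V k w * V l w)) \in Lfun P 1.
    by have [] := mean_sum (index_enum 'I_N) (F1 l).
  have [_ ->] := mean_sum (index_enum 'I_N) Fs.
  rewrite mxE; apply: eq_bigr => l _.
  have [_ ->] := mean_sum (index_enum 'I_N) (F1 l).
  rewrite mxE mulr_suml; apply: eq_bigr => k _.
  by rewrite meanZ// !mxE; ring.
have [||M ME] := psd_factorization (A := A).
- apply/matrixP => k l; rewrite !mxE; apply: (congr1 (mean P)).
  by apply/funext => w; rewrite mulrC.
- by move=> y; rewrite -AE; apply: mean_ge0 => w; exact: sqr_ge0.
by exists M => y; rewrite AE norm2_sqr ME trmx_mul !mulmxA.
Qed.

Lemma std_dev_norm2 (N : nat) (W : T -> 'cV[R]_N) :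
  (forall k, (fun w => W w k 0) \in Lfun P 2%:E) ->
  exists M : 'M[R]_N, forall y : 'cV[R]_N,
    std_dev P (fun w => (y^T *m W w) 0 0) = norm2 (M *m y).
Proof.
move=> W2; pose V k w := W w k 0 - mean P (fun w => W w k 0).
have V2 k : V k \in Lfun P 2%:E by apply: Lfun2D => //; exact: Lfun_cst.
have [M ME] := mean_sqr_norm2 V2; exists M => y.
rewrite /std_dev -[RHS]ger0_norm ?sqrtr_ge0// -sqrtr_sqr; congr Num.sqrt.
rewrite -ME /variance unlock; apply: (congr1 (mean P)); apply/funext => w.
have W1 k : (fun w => y k 0 * W w k 0) \in Lfun P 1 by exact/Lfun1Z/Lfun2_Lfun1.
have yW : (fun w => (y^T *m W w) 0 0) = fun w => \sum_k y k 0 * W w k 0.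
  by apply/funext => v; rewrite mxE; apply: eq_bigr => k _; rewrite mxE.
have [_ mE] := mean_sum (index_enum 'I_N) W1.
pose Y w := (y^T *m W w) 0 0; transitivity ((Y w - mean P Y) ^+ 2); first by [].
rewrite [Y]yW mE /= -sumrB; congr (_ ^+ 2); apply: eq_bigr => k _.
by rewrite meanZ; [rewrite -mulrBr | exact/Lfun2_Lfun1].
Qed.

Lemma mean_mulmx (N : nat) (W : T -> 'cV[R]_N) (y : 'cV[R]_N) :
  (forall k, (fun w => W w k 0) \in Lfun P 2%:E) ->
  mean P (fun w => (y^T *m W w) 0 0) =
    (y^T *m \col_k mean P (fun w => W w k 0)) 0 0.
Proof.
move=> W2.
have W1 k : (fun w => y k 0 * W w k 0) \in Lfun P 1 by exact/Lfun1Z/Lfun2_Lfun1.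
rewrite (_ : (fun _ => _) = fun w => \sum_k y k 0 * W w k 0); last first.
  by apply/funext => v; rewrite mxE; apply: eq_bigr => k _; rewrite mxE.
have [_ ->] := mean_sum (index_enum 'I_N) W1.
by rewrite mxE; apply: eq_bigr => k _; rewrite !mxE meanZ//; exact/Lfun2_Lfun1.
Qed.

(** The entry 1 appended to [x] carries the constant term, so splitting off the last column of [M]
    and the last entry of [mu] yields the affine data. The sign of [kappa] lets it be absorbed into
    the norm. *)
Lemma chance_constraint_soc (K : nat) (W : T -> 'cV[R]_(K + 1)) (kappa : R) :
  (forall k, (fun w => W w k 0) \in Lfun P 2%:E) -> 0 <= kappa ->
  exists C : soc_constraint K, forall x : 'cV[R]_K,
    let Y w := ((col_mx x 1%:M)^T *m W w) 0 0 in
    soc_holds C x <-> mean P Y + kappa * std_dev P Y <= 0.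
Proof.
move=> W2 k0; have [M ME] := std_dev_norm2 W2.
pose mu := \col_k mean P (fun w => W w k 0).
exists (SOCConstraint (kappa *: lsubmx M) (kappa *: rsubmx M)
  (- usubmx mu) (- dsubmx mu 0 0)) => x /=.
rewrite /soc_holds /= ME (mean_mulmx _ W2) -/mu.
have -> : M *m col_mx x 1%:M = lsubmx M *m x + rsubmx M.
  by rewrite -{1}[M]hsubmxK mul_row_col mulmx1.
have -> : ((col_mx x 1%:M)^T *m mu) 0 0 = (x^T *m usubmx mu) 0 0 + dsubmx mu 0 0.
  by rewrite -{1}[mu]vsubmxK tr_col_mx mul_row_col trmx1 mul1mx mxE.
have -> : ((- usubmx mu)^T *m x) 0 0 = - (x^T *m usubmx mu) 0 0.
  rewrite linearN mulNmx !mxE; congr (- _); apply: eq_bigr => k _.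
  by rewrite !mxE mulrC.
rewrite -norm2Z// scalerDr scalemxAl.
by split; lra.
Qed.

End affine_families.

(** * The two kinds of chance constraint in real coordinates *)

Section constraints.
Local Open Scope complex_scope.
Local Open Scope sesquilinear_scope.
Context {R : realType} {dT : measure_display} {T : measurableType dT}.
Variable P : probability T R.

(** The bilinear product becomes a Hermitian one after conjugating [ztilde z], which brings [phi]
    within reach of the CES hypothesis. *)
Lemma phi_re_inner n (d : T -> 'cV[R[i]]_(n + 1)) z :
  phi d z = re_inner d (map_mx Num.conj (ztilde z)).
Proof.
apply/funext => w; rewrite /phi /re_inner innerE mxE; congr complex.Re.
by apply: eq_bigr => j _; rewrite ![_^T _ _]mxE [map_mx _ _ _ _]mxE conjCK mulrC.
Qed.

Lemma re_innerC n (c z : 'cV[R[i]]_n) :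
  complex.Re ((c ^t* *m z) 0 0) = complex.Re ((z ^t* *m c) 0 0).
Proof.
rewrite !innerE !cRe_sum; apply: eq_bigr => j _.
by rewrite !cReM !cRe_conj !cIm_conj; ring.
Qed.

Lemma col_mx_Lfun2 m n (A : T -> 'cV[R]_m) (B : T -> 'cV[R]_n) :
  (forall k, (fun w => A w k 0) \in Lfun P 2%:E) ->
  (forall k, (fun w => B w k 0) \in Lfun P 2%:E) ->
  forall k, (fun w => col_mx (A w) (B w) k 0) \in Lfun P 2%:E.
Proof.
move=> A2 B2 k; case: (split_ordP k) => j ->.
  by under eq_fun do rewrite col_mxEu.
by under eq_fun do rewrite col_mxEd.
Qed.

Lemma const_col_Lfun2 m (A : 'cV[R]_m) k : (fun _ : T => A k 0) \in Lfun P 2%:E.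
Proof. exact: Lfun_cst. Qed.

Variables (n : nat) (kappa : R).
Hypothesis kappa_ge0 : 0 <= kappa.

Lemma phi_soc (d : T -> 'cV[R[i]]_(n + 1)) : L2_vector P d ->
  exists C : soc_constraint (n + n + 1), forall z t,
    soc_holds C (real_coordinates (z, t)) <->
    mean P (phi d z) + kappa * std_dev P (phi d z) <= 0.
Proof.
move=> d2.
(* The blocks are the coefficients in [phi d z] of Re z, Im z, t and 1; t does not occur in it,
   hence the 0. *)
pose W w : 'cV[R]_(n + n + 1 + 1) :=
  col_mx (col_mx (col_mx (map_mx (@complex.Re R) (usubmx (d w)))
                         (- map_mx (@complex.Im R) (usubmx (d w)))) 0)
         (map_mx (@complex.Re R) (dsubmx (d w))).
have W2 k : (fun w => W w k 0) \in Lfun P 2%:E.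
  move: k; do 3?[apply: col_mx_Lfun2] => k; last 2 first.
  - exact: const_col_Lfun2.
  - by under eq_fun do rewrite !mxE; case: (d2 (rshift n k)).
  - by under eq_fun do rewrite !mxE; case: (d2 (lshift 1 k)).
  - under eq_fun do rewrite !mxE -mulN1r.
    by apply: Lfun2Z; case: (d2 (lshift 1 k)).
have [C CE] := chance_constraint_soc W2 kappa_ge0; exists C => z t.
rewrite (CE (real_coordinates (z, t))) (_ : (fun _ => _) = phi d z)//.
apply/funext => w; rewrite /phi /ztilde -[d w in RHS]vsubmxK.
rewrite !tr_col_mx !mul_row_col mulmx0 addr0 trmx1 mul1mx mulmx1.
rewrite [LHS]mxE [in RHS]mxE cReD; congr (_ + _); last by rewrite !mxE.
rewrite !mxE cRe_sum -big_split; apply: eq_bigr => j _ /=.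
by rewrite !mxE cReM; ring.
Qed.

Lemma objective_soc (c : T -> 'cV[R[i]]_n) : L2_vector P c ->
  exists C : soc_constraint (n + n + 1), forall z t,
    soc_holds C (real_coordinates (z, t)) <->
    mean P (re_inner c z) + kappa * std_dev P (re_inner c z) <= t.
Proof.
move=> c2.
(* Here t has coefficient -1 and the constant term is 0: the bound t moves to the left side,
   shifting the mean and leaving the standard deviation unchanged. *)
pose W w : 'cV[R]_(n + n + 1 + 1) :=
  col_mx (col_mx (col_mx (map_mx (@complex.Re R) (c w))
                         (map_mx (@complex.Im R) (c w))) (- 1)%:M) 0.
have W2 k : (fun w => W w k 0) \in Lfun P 2%:E.
  move: k; do 3?[apply: col_mx_Lfun2] => k; last 2 first.
  - exact: const_col_Lfun2.
  - exact: const_col_Lfun2.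
  - by under eq_fun do rewrite !mxE; case: (c2 k).
  - by under eq_fun do rewrite !mxE; case: (c2 k).
have [C CE] := chance_constraint_soc W2 kappa_ge0; exists C => z t.
have h2 := re_inner_Lfun2 z c2.
rewrite (CE (real_coordinates (z, t))) (_ : (fun _ => _) = fun w => re_inner c z w - t).
  rewrite meanD ?Lfun_cst1 ?Lfun2_Lfun1// mean_cst.
  rewrite [std_dev P (fun _ => _)](_ : _ = std_dev P (re_inner c z)).
    by split; lra.
  by rewrite /std_dev -[X in variance P X]/(re_inner c z \- cst t) varianceB_cst_r.
apply/funext => w; rewrite /re_inner innerE.
rewrite !tr_col_mx !mul_row_col mulmx0 addr0 tr_scalar_mx -scalar_mxM mulrN1.
rewrite [LHS]mxE; congr (_ + _); last by rewrite mxE mulr1n.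
rewrite !mxE cRe_sum -big_split; apply: eq_bigr => j _ /=.
by rewrite !mxE cReM cRe_conj cIm_conj; ring.
Qed.

Lemma real_coordinates_bij : bijective (@real_coordinates R n).
Proof.
exists (fun x => (\col_j (usubmx (usubmx x) j 0 +i* dsubmx (usubmx x) j 0), dsubmx x 0 0)).
  move=> [z t]; rewrite /real_coordinates /= !col_mxKu !col_mxKd; congr (_, _).
    by apply/colP => j; rewrite !mxE; case: (z j 0).
  by rewrite mxE eqxx mulr1n.
move=> x; rewrite /real_coordinates /= -[RHS]vsubmxK; congr col_mx.
  rewrite -[RHS]vsubmxK; congr col_mx; apply/colP => j; by rewrite !mxE.
by rewrite -mx11_scalar.
Qed.

End constraints.

Local Open Scope sesquilinear_scope.

Theorem theorem4p2 (R : realType)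
  (dT : measure_display) (T : measurableType dT) (P : probability T R)
  (n m : nat) (psi : R -> R[i])
  (c : T -> 'cV[R[i]]_n) (d : 'I_m -> T -> 'cV[R[i]]_(n + 1))
  (hc : CES P psi c) (hd : forall i, CES P psi (d i))
  (dS : measure_display) (S : measurableType dS) (Q : probability S R)
  (X : {RV Q >-> R}) (hX : standard_elliptical psi X) :
  (forall p : 'I_m -> R, (forall i, 2^-1 <= p i < 1) ->
    forall (z : 'cV[R[i]]_n) (i : 'I_m),
      ((p i)%:E <= P [set w | (phi (d i) z w <= 0)%R])%E <->
      mean P (phi (d i) z) +
        quantile (cdf X) (p i) * std_dev P (phi (d i) z) <= 0)
  /\
  (forall (p0 : R) (p : 'I_m -> R),
    2^-1 <= p0 < 1 -> (forall i, 2^-1 <= p i < 1) ->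
    (p0 = 2^-1 \/ (exists i, p i = 2^-1) ->
      zero_unique_median (cdf X)) ->
    exists (L : nat) (h : 'cV[R]_(n + n + 1))
           (C : 'I_L -> soc_constraint (n + n + 1)),
      equivalent_via (@real_coordinates R n)
        (chance_problem P c d p0 p) (socp h C)).
Proof.
have half_gt0 (q : R) : 2^-1 <= q < 1 -> 0 < q < 1 by lra.
have chance (p : 'I_m -> R) : (forall i, 2^-1 <= p i < 1) -> forall z i,
    ((p i)%:E <= P [set w | (phi (d i) z w <= 0)%R])%E <->
    mean P (phi (d i) z) + quantile (cdf X) (p i) * std_dev P (phi (d i) z) <= 0.
  move=> hp z i; rewrite phi_re_inner.
  by apply: (CES_chance_constraint _ (hd i) hX); exact: half_gt0.
split=> // p0 p hp0 hp hmed.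
have k0 : 0 <= quantile (cdf X) p0.
  by apply: (standard_elliptical_quantile_ge0 hX) => // ?; apply: hmed; left.
have k i : 0 <= quantile (cdf X) (p i).
  by apply: (standard_elliptical_quantile_ge0 hX) => // ?; apply: hmed; right; exists i.
have [C0 C0E] := objective_soc k0 hc.1.
have /choice[C CE] i := phi_soc (k i) (hd i).1.
(* The cost vector selects the last coordinate, t. Index block 1 holds the constraint bounding
   Re(c^H z) by t, block m the constraints on the [d i]. *)
exists (1 + m)%N, (col_mx 0 1%:M),
  (fun l : 'I_(1 + m) => match fintype.split l with inl _ => C0 | inr i => C i end).
split; first exact: real_coordinates_bij.
move=> [z t]; split.
  by rewrite /= tr_col_mx mul_row_col trmx0 mul0mx add0r trmx1 mul1mx mxE mulr1n.
have obj : (p0%:E <= P [set w | (complex.Re (((c w) ^t* *m z) 0 0) <= t)%R])%E <->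
    soc_holds C0 (real_coordinates (z, t)).
  under eq_set do rewrite re_innerC.
  by rewrite C0E; apply: (CES_chance_constraint _ hc hX); exact: half_gt0.
split=> [[/obj h0 hi] l|hl].
- by case: fintype.splitP => // i _; apply/CE/chance => //; exact: hi.
- split=> [|i]; first by apply/obj; have := hl (lshift m 0); rewrite /= (unsplitK (inl _)).
  apply/chance => //; apply/CE; have := hl (rshift 1 i); rewrite /= (unsplitK (inr _)).
  by apply.
Qed.
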